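(* Let $G$ be an $r$-graph with vertex set $[n]$ and with at least one edge. Let $\tau,\zeta>0$ satisfy $\delta(G,\tau)\le\zeta$. Then there is a function $C:\mathcal{P}([n])^r\to\mathcal{P}([n])$ such that, for every independent set $I\subset[n]$, there exists $T=(T_{r-1},\ldots,T_0)\in\mathcal{P}(I)^r$ with (a) $I\subset C(T)$, (b) $\mu(T_0),\ldots,\mu(T_{r-1})\le 2\tau/\zeta$, (c) $|T_0|,\ldots,|T_{r-1}|\le 2\tau n/\zeta^2$, and (d) $\mu(C(T))\le 1-\dfrac{1}{r!}+4\zeta+\dfrac{2r\tau}{\zeta}$. Moreover, if $G$ is simple then $C(T)\cap[w]=C(T\cap[w])\cap[w]$ for all $T\in\mathcal{P}([n])^r$ and $w\in[n]$. In fact, with the same function $C$, for every set $I\subset[n]$ (not necessarily independent) for which either $G[I]$ is $\lfloor\tau^{r-1}\zeta e(G)/n\rfloor$-degenerate or $e(G[I])\le 2r\tau^r e(G)/\zeta$, there exists $T=(T_{r-1},\ldots,T_0)\in\mathcal{P}(I)^r$ with $I\subset C(T)$, $\mu(T_0),\ldots,\mu(T_{r-1})\le 2\tau/\zeta$, $|T_0|,\ldots,|T_{r-1}|\le 2\tau n/\zeta^2$, and $\mu(C(T))\le 1-\dfrac{1}{r!}+4\zeta+\dfrac{2r\tau}{\zeta}$.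
   Context: An $r$-graph is an $r$-uniform hypergraph $G=(V(G),E(G))$; $e(G)=|E(G)|$; $G[S]$ is the subhypergraph induced by $S\subset V(G)$; $\mathcal{P}(S)$ is the set of subsets of $S$; $[n]=\{1,\ldots,n\}$. A set $I\subset V(G)$ is independent if no edge of $G$ is contained in $I$. $G$ is simple if every pair of vertices lies in at most one edge. An $r$-graph $F$ is $b$-degenerate if $e(F[S])\le b|S|$ for every $S\subset V(F)$. For $T=(T_{r-1},\ldots,T_0)\in\mathcal{P}([n])^r$ and $w\in[n]$, $T\cap[w]=(T_{r-1}\cap[w],\ldots,T_0\cap[w])$. For $\sigma\subset V(G)$, the degree $d(\sigma)$ is the number of edges containing $\sigma$, and $d(v)=d(\{v\})$. Let $G$ have order $n$ and average degree $d$. Degree measure: for $S\subset V(G)$, $\mu(S)=\frac{1}{nd}\sum_{u\in S}d(u)$. Co-degree function: let $\tau>0$. For $v\in V(G)$ and $2\le j\le r$ let $d^{(j)}(v)=\max\{d(\sigma): v\in\sigma\subset V(G),\ |\sigma|=j\}$. If $d>0$, define $\delta_j$ by $\delta_j\,\tau^{j-1}nd=\sum_v d^{(j)}(v)$, and $$\delta(G,\tau)=2^{\binom r2-1}\sum_{j=2}^r2^{-\binom{j-1}{2}}\delta_j .$$ If $d=0$, $\delta(G,\tau)=0$. *)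

(* Defs.v *)
From mathcomp Require Import all_boot all_order all_algebra.
From mathcomp Require Import reals.

Set Implicit Arguments.
Unset Strict Implicit.
Unset Printing Implicit Defensive.

Import Order.TTheory GRing.Theory Num.Theory.

Local Open Scope ring_scope.

(* The vertex set is a set over an ambient finite type, so that an induced
   subhypergraph G[S] is again an r-graph, with vertex set S. *)
Record hypergraph (V : finType) (r : nat) := Hypergraph {
  vset : {set V};
  edges : {set {set V}};
  edges_wf : [forall e in edges, (e \subset vset) && (#|e| == r)]
}.

Section Hypergraph.
Variables (V : finType) (r : nat).
Implicit Types (G F : hypergraph V r) (S I sigma : {set V}).

Definition nedges G : nat := #|edges G|.

Lemma induced_wf G S :
  [forall e in [set e in edges G | e \subset S],
    (e \subset vset G :&: S) && (#|e| == r)].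
Proof.
apply/forall_inP => e; rewrite inE => /andP[eG eS].
by have /forall_inP/(_ e eG)/andP[eV ->] := edges_wf G; rewrite subsetI eV eS.
Qed.

Definition induced G S : hypergraph V r := Hypergraph (induced_wf G S).

Definition is_independent G I : Prop :=
  I \subset vset G /\ forall e, e \in edges G -> ~~ (e \subset I).

Definition degree G sigma : nat := #|[set e in edges G | sigma \subset e]|.

Definition is_simple G : Prop :=
  forall u v, u \in vset G -> v \in vset G -> u != v ->
    (degree G [set u; v] <= 1)%N.

Definition is_degenerate (b : int) F : Prop :=
  forall S, S \subset vset F -> (nedges (induced F S))%:Z <= b * #|S|%:Z.

Definition codegree G (j : nat) (v : V) : nat :=
  \max_(sigma : {set V} |
     [&& v \in sigma, sigma \subset vset G & #|sigma| == j]) degree G sigma.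

Section Real.
Variable R : realType.
Implicit Type tau : R.

Definition avg_degree G : R :=
  (\sum_(v in vset G) (degree G [set v])%:R) / #|vset G|%:R.

Definition degree_measure G S : R :=
  (\sum_(u in S) (degree G [set u])%:R) / (#|vset G|%:R * avg_degree G).

Definition delta_j G tau (j : nat) : R :=
  (\sum_(v in vset G) (codegree G j v)%:R)
    / (tau ^+ j.-1 * #|vset G|%:R * avg_degree G).

(* The truncated predecessor of 'C(r, 2) only differs from 'C(r, 2) - 1 when
   r <= 1, in which case the sum is empty. *)
Definition codegree_fun G tau : R :=
  if 0 < avg_degree G then
    2 ^+ 'C(r, 2).-1 * \sum_(2 <= j < r.+1) 2 ^- 'C(j.-1, 2) * delta_j G tau j
  else 0.

End Real.
End Hypergraph.

Section Tuples.
Variables (n r : nat).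

(* [n] is represented by 'I_n, the ordinal i standing for the integer i + 1;
   hence [w] consists of the ordinals i < w. *)
Definition initseg (w : nat) : {set 'I_n} := [set i : 'I_n | (i < w)%N].

(* (T_{r-1}, ..., T_0) is represented by the function i |-> T_i. *)
Definition set_tuple := {ffun 'I_r -> {set 'I_n}}.

Definition tuple_cap (T : set_tuple) (w : nat) : set_tuple :=
  [ffun i => T i :&: initseg w].

End Tuples.

(* Main.v *)
Require Import Defs.
From mathcomp Require Import all_boot all_order all_algebra.
From mathcomp Require Import reals.
From mathcomp Require Import ring lra zify.

(** A set [I] containing few edges is compressed into a small tuple, its fingerprint, by
an algorithm that passes through levels [r], [r - 1], ..., [0]. Level [s] is an
[s]-uniform multihypergraph: some edges [e] of [G], each represented by the set
[suf s e] of its [s] largest vertices; level [r] is [G]. To obtain level [s], the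
vertices [v] are examined in increasing order. The fresh edges of [v] are the edges of
level [s + 1] with first vertex [v] whose remaining vertices contain no set that has
already reached its cap in level [s]. When they are numerous and the degree of [v] is
not too low, [v] is hit; if moreover [v] is in [I], it is picked and its fresh edges
enter level [s]. Since only picked vertices influence the run, it can be reconstructed
from the picked sets ([hits_picked]). The container consists of the vertices that are
never hit without being picked, so it contains [I].

The fingerprint is small because the degrees of level [s] are capped near
[tau ^ (r - s) * d u], whereas each picked vertex brings at least
[zeta * tau ^ (r - s - 1) * d v] edges ([measure_picked]). At level [0], the edges
of the picked vertices lie inside the union of the picked sets, hence inside [I], and
the sparsity of [I] bounds their number ([card_picked0], [measure_picked0]).

The container is small for the following reason. Let [X] be the set of all vertices
that are hit or of low degree. An edge of level [s + 1] that misses [X] is rarely fresh,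
so it usually contains a set whose degree in level [s] has reached its cap; such edges
can be charged to the degrees of level [s] outside [X] ([level_bound]). This bounds the
degree sum of level [s + 1] outside [X] by that of level [s]. At level [1] nothing can be
charged, since all vertices that have reached their cap are in [X]; at level [r] the bound
becomes [1 - mu X <= (r! - 1) * mu X + 3 * r! * zeta], that is,
[1 / r! <= mu X + 3 * zeta] ([uncovered_bound], [measure_covered]). A degree may exceed
its cap by a codegree of the level above ([ldeg_overshoot]); the weights in the codegree
function are chosen so that the hypothesis on [G] passes to every level
([codweight_bound]) and keeps these excesses small.

If [G] is simple, sets of two or more vertices never block an edge, so the membership of
[v] in the container depends only on the part of the fingerprint up to [v]
([container_simple]). *)

Set Implicit Arguments.
Unset Strict Implicit.
Unset Printing Implicit Defensive.

Import Order.TTheory GRing.Theory Num.Theory.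

Local Open Scope ring_scope.

(** * The largest vertices of an edge *)

Section Suffix.
Variable n : nat.
Implicit Types (e : {set 'I_n}) (v y : 'I_n).

Definition suf (s : nat) e : {set 'I_n} :=
  [set x in drop (#|e| - s) (enum e)].

Definition lead (s : nat) e : {set 'I_n} := suf s.+1 e :\: suf s e.

Lemma suf_sub s e : suf s e \subset e.
Proof. by apply/subsetP => x; rewrite inE => /mem_drop; rewrite mem_enum. Qed.

Lemma sufS s e : suf s e \subset suf s.+1 e.
Proof.
apply/subsetP => x; rewrite !inE => xs.
have [le_es|lt_se] := leqP #|e| s.
  have -> : (#|e| - s.+1 = #|e| - s)%N by lia.
  by [].
have eq : (#|e| - s = 1 + (#|e| - s.+1))%N by lia.
by move: xs; rewrite eq -drop_drop => /mem_drop.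
Qed.

Lemma card_suf s e : (s <= #|e|)%N -> #|suf s e| = s.
Proof.
move=> le_se; rewrite cardsE (card_uniqP _) ?drop_uniq ?enum_uniq //.
by rewrite size_drop -cardE subKn.
Qed.

Lemma suf_full s e : #|e| = s -> suf s e = e.
Proof.
by move=> es; apply/eqP; rewrite eqEcard suf_sub card_suf es /=.
Qed.

Lemma suf0 e : suf 0 e = set0.
Proof. by apply/eqP; rewrite -cards_eq0 card_suf. Qed.

Lemma card_lead s e : (s < #|e|)%N -> #|lead s e| = 1%N.
Proof.
move=> lt_se; rewrite cardsD (setIidPr (sufS _ _)) !card_suf ?subSnn //.
exact: ltnW.
Qed.

Lemma sorted_enum e : sorted ltn (map val (enum e)).
Proof.
rewrite /enum_mem -enumT; apply: (@subseq_sorted _ ltn ltn_trans _ (map val (enum 'I_n))).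
  by rewrite map_subseq // filter_subseq.
by rewrite val_enum_ord iota_ltn_sorted.
Qed.

Lemma lead_lt s e v y : v \in lead s e -> y \in suf s e -> (v < y)%N.
Proof.
rewrite !inE => /andP[vNs vs] ys.
have := sorted_enum e; rewrite -[enum e](cat_take_drop (#|e| - s)) map_cat.
rewrite (sorted_pairwise ltn_trans) pairwise_cat => /and3P[/allrelP lt _ _].
apply: lt; rewrite (mem_map val_inj) //.
have := mem_drop vs; rewrite -{1}[enum e](cat_take_drop (#|e| - s)) mem_cat.
by rewrite (negbTE vNs) orbF.
Qed.

End Suffix.

(** * The algorithm *)

Section Algorithm.
Variables (R : realType) (n r : nat) (G : hypergraph 'I_n r) (tau zeta : R).
Implicit Types (E A : {set {set 'I_n}}) (e sigma S : {set 'I_n}) (v u : 'I_n).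
Implicit Types (F : nat -> {set 'I_n}) (s k : nat).

(** Level [s] is an [s]-uniform multihypergraph: its edges are the sets [suf s e], kept
apart by the edge [e] of [G] that they come from. This is the degree of [sigma] in it. *)
Definition ldeg s A sigma : nat := #|[set e in A | sigma \subset suf s e]|.

(** Each step down thins the hypergraph out by a factor of about [tau], whence the cap on
the degree of a vertex. The factor [2 ^ (s - 1)] on larger sets is big enough for
[card_subsets_ge2] to absorb all blocking by such sets, and small enough for codegrees
to stay under control in [codweight_step]. *)
Definition cap s E sigma : R :=
  if #|sigma| == 1%N then tau ^+ (r - s) * (degree G sigma)%:R
  else 2 ^+ s.-1 * tau * (ldeg s.+1 E sigma)%:R.

Definition blocked s E A e : bool :=
  [exists sigma : {set 'I_n}, [&& sigma \subset suf s e, sigma != set0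
     & cap s E sigma <= (ldeg s A sigma)%:R]].

Definition fresh s E A v : {set {set 'I_n}} :=
  [set e in E | (v \in lead s e) && ~~ blocked s E A e].

(** Only vertices of substantial degree are picked, so that a bound on the measure of the
fingerprint also bounds its cardinality. Strictness makes [card_picked0] work for
[r = 1] too. *)
Definition heavy v : bool := zeta * avg_degree R G < (degree G [set v])%:R.

(** Without the factor [zeta], being hit at level [0] amounts to being saturated at level
[1]; the sparsity of the set to be covered pays for this level. *)
Definition demand s v : R :=
  (if s is 0 then 1 else zeta) * tau ^+ (r - s.+1) * (degree G [set v])%:R.

Definition hit s E A v : bool :=
  heavy v && (demand s v <= #|fresh s E A v|%:R).

Fixpoint link s E S k : {set {set 'I_n}} :=
  if k is k'.+1 then
    let A := link s E S k' in
    A :|: \bigcup_(v in S | (val v == k') && hit s E A v) fresh s E A v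
  else set0.

(** [F s] is the set of vertices allowed to be picked at level [s]; the recursion runs on
the number [t = r - s] of levels already left. *)
Fixpoint levels F t : {set {set 'I_n}} :=
  if t is t'.+1 then link (r - t'.+1) (levels F t') (F (r - t'.+1)%N) n
  else edges G.

Definition level F s : {set {set 'I_n}} := levels F (r - s).

Definition before F s v : {set {set 'I_n}} := link s (level F s.+1) (F s) v.

Definition hits F s : {set 'I_n} :=
  [set v | hit s (level F s.+1) (before F s v) v].

Definition picked F s : {set 'I_n} := F s :&: hits F s.

(** A hit vertex of the set to be covered is always picked, so a hit vertex that is not
allowed can be discarded. *)
Definition container F : {set 'I_n} :=
  [set v | [forall s : 'I_r, (v \in hits F s) ==> (v \in F s)]].

Lemma mem_link s E S k e :
  reflect (exists v : 'I_n, [/\ (v < k)%N, v \in S, hit s E (link s E S v) v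
             & e \in fresh s E (link s E S v) v]) (e \in link s E S k).
Proof.
apply: (iffP idP); last first.
  case=> v [lt_vk vS vhit eF]; have -> : k = (v.+1 + (k - v.+1))%N by lia.
  elim: (k - v.+1)%N => [|m IH] /=; last by rewrite addnS /= inE IH.
  rewrite addn0 /= inE; apply/orP; right; apply/bigcupP; exists v => //.
  by rewrite vS eqxx.
elim: k => [|k IH] /=; first by rewrite inE.
rewrite inE => /orP[/IH[v [lt_vk vS vhit eF]]|].
  by exists v; split => //; lia.
by case/bigcupP => v /and3P[vS /eqP vk vhit] eF; exists v; rewrite -vk in vhit eF *.
Qed.

Lemma link_sub s E S k : link s E S k \subset E.
Proof. by apply/subsetP => e /mem_link[v [_ _ _]]; rewrite inE => /andP[]. Qed.

Lemma link_mono s E S k k' : (k <= k')%N -> link s E S k \subset link s E S k'.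
Proof.
move=> le_kk'; apply/subsetP => e /mem_link[v [lt_vk vS vhit eF]].
by apply/mem_link; exists v; split => //; lia.
Qed.

Lemma level_ind (P : nat -> Prop) :
  P r -> (forall s, (s < r)%N -> P s.+1 -> P s) ->
  forall s, (s <= r)%N -> P s.
Proof.
move=> Pr IH s le_sr; rewrite -(subKn le_sr).
elim: (r - s)%N (leq_subr s r) => [|m Pm] le_mr; first by rewrite subn0.
by apply: IH; [lia | rewrite subnSK //; exact: Pm (ltnW le_mr)].
Qed.

Lemma level_top F : level F r = edges G.
Proof. by rewrite /level subnn. Qed.

Lemma levelE F s : (s < r)%N -> level F s = link s (level F s.+1) (F s) n.
Proof.
move=> lt_sr; rewrite /level; have -> : (r - s = (r - s.+1).+1)%N by lia.
by rewrite /=; have -> : (r - (r - s.+1).+1 = s)%N by lia.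
Qed.

Lemma level_sub F s : (s < r)%N -> level F s \subset level F s.+1.
Proof. by move=> lt_sr; rewrite levelE // link_sub. Qed.

Lemma level_edges F s : (s <= r)%N -> level F s \subset edges G.
Proof.
move: s; apply: level_ind => [|s lt_sr IH]; first by rewrite level_top.
exact: subset_trans (level_sub F lt_sr) IH.
Qed.

Lemma before_sub F s v : (s < r)%N -> before F s v \subset level F s.
Proof. by move=> lt_sr; rewrite levelE //; apply: link_mono; exact: ltnW. Qed.

Lemma mem_level F s e : (s < r)%N -> e \in level F s ->
  exists v, [/\ v \in picked F s, v \in lead s e & e \in level F s.+1].
Proof.
move=> lt_sr; rewrite levelE // => /mem_link[v [_ vS vhit]].
by rewrite inE => /and3P[eE vl _]; exists v; split => //; rewrite inE vS inE.
Qed.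

Lemma fresh_level F s v : (s < r)%N -> v \in picked F s ->
  fresh s (level F s.+1) (before F s v) v
    \subset [set e in level F s | v \in lead s e].
Proof.
move=> lt_sr; rewrite !inE => /andP[vS vhit]; apply/subsetP => e eF.
rewrite inE; move: (eF); rewrite inE => /and3P[_ -> _]; rewrite andbT levelE //.
by apply/mem_link; exists v; split.
Qed.

Lemma link_hit s E S k :
  link s E (S :&: [set v : 'I_n | hit s E (link s E S v) v]) k = link s E S k.
Proof.
elim: k => [//|k /= ->]; congr (_ :|: _); apply: eq_bigl => v.
rewrite !inE; case: (v \in S) => //=.
by case: (eqVneq (val v) k) => [<-|_] /=; rewrite ?andbb ?andbF.
Qed.

(** Running the algorithm on the picked vertices alone repeats every choice, so that the
run on a set can be reconstructed from its fingerprint. *)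
Lemma level_picked F F' : (forall s, (s < r)%N -> F' s = picked F s) ->
  forall s, (s <= r)%N -> level F' s = level F s.
Proof.
move=> F'E; apply: level_ind => [|s lt_sr IH]; first by rewrite !level_top.
by rewrite (levelE F' lt_sr) (levelE F lt_sr) IH F'E // link_hit.
Qed.

Lemma hits_picked F F' : (forall s, (s < r)%N -> F' s = picked F s) ->
  forall s, (s < r)%N -> hits F' s = hits F s.
Proof.
move=> F'E s lt_sr; apply/setP => v.
by rewrite !inE /before (level_picked F'E) // F'E // link_hit.
Qed.

End Algorithm.

(** * Degrees and codegrees of the levels *)

Section Codegrees.
Variables (R : realType) (n r : nat) (G : hypergraph 'I_n r) (tau zeta : R).
Hypothesis (tau_gt0 : 0 < tau).
Implicit Types (E A : {set {set 'I_n}}) (e sigma S : {set 'I_n}) (v u : 'I_n).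
Implicit Types (F : nat -> {set 'I_n}) (s k : nat).

Local Notation level := (level G tau zeta).
Local Notation cap := (cap G tau).
Local Notation d v := ((degree G [set v])%:R : R).
Local Notation degsum := (\sum_v (degree G [set v])%:R : R).

Lemma card_edge e : e \in edges G -> #|e| = r.
Proof. by move=> eG; have /forall_inP/(_ e eG)/andP[_ /eqP] := edges_wf G. Qed.

Lemma ldeg_mono s A A' sigma : A \subset A' -> (ldeg s A sigma <= ldeg s A' sigma)%N.
Proof.
move=> sAA'; apply/subset_leq_card/subsetP => e; rewrite !inE => /andP[eA ->].
by rewrite (subsetP sAA').
Qed.

Lemma ldeg_top sigma : ldeg r (edges G) sigma = degree G sigma.
Proof.
apply: eq_card => e; rewrite !inE; case eG: (e \in edges G) => //=.
by rewrite suf_full // card_edge.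
Qed.

Lemma cap_ge0 s E sigma : 0 <= cap s E sigma.
Proof.
rewrite /cap; case: ifP => _; first by rewrite mulr_ge0 ?exprn_ge0 // ltW.
by rewrite !mulr_ge0 ?exprn_ge0 // ltW.
Qed.

(** Once the degree of [sigma] reaches its cap no further edge through [sigma] is
collected, and the vertex [v] that makes it cross the cap contributes at most
the degree of [v |: sigma] one level up. *)
Lemma ldeg_overshoot F s sigma (B : R) : (s < r)%N -> sigma != set0 -> 0 <= B ->
  (forall w, w \notin sigma ->
    (ldeg s.+1 (level F s.+1) (w |: sigma))%:R <= B) ->
  (ldeg s (level F s) sigma)%:R <= cap s (level F s.+1) sigma + B.
Proof.
move=> lt_sr sigma0 B0 leB; rewrite levelE //.
suff: forall k, (ldeg s (link G tau zeta s (level F s.+1) (F s) k) sigma)%:R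
    <= cap s (level F s.+1) sigma + B by [].
elim=> [|k IH] /=.
  rewrite /ldeg (_ : [set _ in _ | _] = set0) ?cards0 ?addr_ge0 ?cap_ge0 //.
  by apply/setP => e; rewrite !inE.
set A := link _ _ _ _ _ _ k in IH *.
set N := \bigcup_(v in _ | _) _.
have [le_cap|lt_cap] := lerP (cap s (level F s.+1) sigma) (ldeg s A sigma)%:R.
  apply: le_trans IH; rewrite ler_nat; apply/subset_leq_card/subsetP => e.
  rewrite !inE => /andP[/orP[->//|/bigcupP[v _]]].
  rewrite inE => /and3P[_ _ /existsP nblk] sub.
  by case: nblk; exists sigma; rewrite sub sigma0.
have leN : (ldeg s N sigma)%:R <= B.
  rewrite /ldeg; set X := [set _ in _ | _].
  have [->|[e0]] := set_0Vmem X; first by rewrite cards0.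
  rewrite inE => /andP[/bigcupP[v /and3P[_ /eqP vk _]]].
  rewrite inE => /and3P[_ vl _] sub0.
  have vNs : v \notin sigma.
    by apply/negP => /(subsetP sub0) vs; move: vl; rewrite inE vs.
  apply: le_trans (leB v vNs); rewrite ler_nat.
  apply/subset_leq_card/subsetP => e; rewrite !inE => /andP[/bigcupP[w]].
  move=> /and3P[_ /eqP wk _]; rewrite inE => /and3P[-> wl _] sub.
  have <- : w = v by apply: val_inj; exact: etrans wk (esym vk).
  rewrite subUset sub1set (subset_trans sub (sufS _ _)) andbT.
  by move: wl; rewrite inE => /andP[].
apply: le_trans (lerD (ltW lt_cap) leN); rewrite -natrD ler_nat.
rewrite /ldeg -cardsUI; apply: leq_trans (leq_addr _ _).
apply/subset_leq_card/subsetP => e; rewrite !inE.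
by case/andP=> /orP[] -> ->; rewrite ?orbT.
Qed.

Definition lcodeg F s j u : nat :=
  \max_(sigma : {set 'I_n} | (u \in sigma) && (#|sigma| == j))
    ldeg s (level F s) sigma.

Lemma leq_lcodeg F s u sigma : u \in sigma ->
  (ldeg s (level F s) sigma <= lcodeg F s #|sigma| u)%N.
Proof.
move=> us; rewrite /lcodeg.
apply: (@leq_bigmax_cond _ (fun sigma' => (u \in sigma') && (#|sigma'| == #|sigma|))
  (fun sigma' => ldeg s (level F s) sigma')).
by rewrite us eqxx.
Qed.

Lemma lcodeg_step F s j u : (s < r)%N -> (1 < j)%N ->
  (lcodeg F s j u)%:R
    <= 2 ^+ s.-1 * tau * (lcodeg F s.+1 j u)%:R + (lcodeg F s.+1 j.+1 u)%:R.
Proof.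
move=> lt_sr lt1j; rewrite [lcodeg F s j u]/lcodeg.
apply: (big_ind (fun m : nat => m%:R <= _)) => [|a b|sigma /andP[us /eqP cs]].
- by rewrite addr_ge0 // !mulr_ge0 ?exprn_ge0 // ltW.
- by case: (leqP a b).
have sigma0 : sigma != set0 by apply/set0Pn; exists u.
have := @ldeg_overshoot F s sigma (lcodeg F s.+1 j.+1 u)%:R lt_sr sigma0.
move=> /(_ (ler0n _ _)) leO; apply: le_trans (leO _) _ => [w wNs|].
  rewrite ler_nat; have := @leq_lcodeg F s.+1 u (w |: sigma).
  by rewrite cardsU1 wNs cs add1n; apply; rewrite inE us orbT.
rewrite lerD2r /cap cs; case: eqP => [j1|_]; first by move: lt1j; rewrite j1.
by rewrite ler_wpM2l ?mulr_ge0 ?exprn_ge0 ?ler_nat -?cs ?leq_lcodeg // ltW.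
Qed.

(** A bound on the excess of the degree of a vertex over its cap; the top level, where the
cap is the degree itself, has none. *)
Definition overshoot F s u : nat := if (s < r)%N then lcodeg F s.+1 2 u else 0%N.

Lemma ldeg_vertex F s u : (s <= r)%N ->
  (ldeg s (level F s) [set u])%:R
    <= tau ^+ (r - s) * d u + (overshoot F s u)%:R.
Proof.
rewrite leq_eqVlt /overshoot => /orP[/eqP->|lt_sr].
  by rewrite ltnn subnn expr0 mul1r addr0 level_top ldeg_top.
rewrite lt_sr; have u0 : [set u] != set0 by rewrite -card_gt0 cards1.
have := @ldeg_overshoot F s [set u] (lcodeg F s.+1 2 u)%:R lt_sr u0.
move=> /(_ (ler0n _ _)) leO; apply: le_trans (leO _) _ => [w wNs|].
  rewrite ler_nat; have := @leq_lcodeg F s.+1 u (w |: [set u]).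
  by rewrite cardsU1 wNs cards1; apply; rewrite !inE eqxx orbT.
by rewrite /cap cards1 eqxx.
Qed.

Definition codsum F s j : R := \sum_u (lcodeg F s j u)%:R.

Definition codweight F s : R :=
  \sum_(2 <= j < s.+1) 2 ^- 'C(j.-1, 2) * tau ^- j.-1 * codsum F s j.

Lemma codsum_ge0 F s j : 0 <= codsum F s j.
Proof. exact: sumr_ge0. Qed.

(** The weights [2 ^- 'C(j - 1, 2)] are those that make the two contributions to the
codegrees of order [j], from orders [j] and [j + 1] one level up, add up
to at most a factor [2 ^ s * tau]. *)
Lemma codweight_step F s : (s < r)%N ->
  codweight F s <= 2 ^+ s * tau * codweight F s.+1.
Proof.
move=> lt_sr; pose a j := 2 ^- 'C(j.-1, 2) * tau ^- j.-1 * codsum F s.+1 j.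
have a_ge0 j : 0 <= a j.
  by rewrite !mulr_ge0 ?invr_ge0 ?exprn_ge0 ?codsum_ge0 // ltW.
case: s lt_sr @a a_ge0 => [|s] lt_sr a a_ge0.
  by rewrite /codweight !big_geq // mulr0.
(* the terms of order j and those shifted from order j + 1 all occur in the weight
   one level up *)
have half1 : \sum_(2 <= j < s.+2) a j <= codweight F s.+2.
  rewrite /codweight [leRHS]big_nat_recr // lerDl; exact: a_ge0.
have half2 : \sum_(2 <= j < s.+2) a j.+1 <= codweight F s.+2.
  have -> : \sum_(2 <= j < s.+2) a j.+1 = \sum_(3 <= j < s.+3) a j.
    by rewrite [RHS]big_add1.
  by rewrite /codweight [leRHS]big_ltn // lerDr; exact: (a_ge0 2).
have two : codweight F s.+1
    <= 2 ^+ s * tau * (\sum_(2 <= j < s.+2) a j + \sum_(2 <= j < s.+2) a j.+1).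
  rewrite -big_split mulr_sumr /codweight /= !big_seq; apply: ler_sum => j.
  rewrite mem_index_iota => /andP[lt1j lt_js].
  case: j lt1j lt_js => [//|j] lt1j lt_js /=.
  have step : codsum F s.+1 j.+1
      <= 2 ^+ s * tau * codsum F s.+2 j.+1 + codsum F s.+2 j.+2.
    rewrite /codsum mulr_sumr -big_split /=; apply: ler_sum => u _.
    exact: lcodeg_step.
  apply: le_trans (ler_wpM2l _ step) _.
    by rewrite !mulr_ge0 ?invr_ge0 ?exprn_ge0 // ltW.
  rewrite !mulrDr; apply: lerD.
    by rewrite /a /= le_eqVlt; apply/orP; left; apply/eqP; ring.
  have -> : 2 ^- 'C(j, 2) * tau ^- j * codsum F s.+2 j.+2 = 2 ^+ j * tau * a j.+2.
    rewrite /a /= binS bin1 exprD exprS; field.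
    by rewrite !expf_neq0 ?pnatr_eq0 // gt_eqF.
  by rewrite ler_wpM2r // (ler_wpM2r (ltW tau_gt0)) // ler_eXn2l ?ltr1n //; lia.
have c_ge0 : 0 <= 2 ^+ s * tau by rewrite mulr_ge0 ?exprn_ge0 // ltW.
apply: le_trans two (le_trans (ler_wpM2l c_ge0 (lerD half1 half2)) _).
by rewrite exprS le_eqVlt; apply/orP; left; apply/eqP; ring.
Qed.

Hypothesis (GV : vset G = [set: 'I_n]) (G_edge : (0 < nedges G)%N) (r_gt0 : (0 < r)%N).
Hypothesis (zeta_gt0 : 0 < zeta) (G_delta : codegree_fun G tau <= zeta).

Lemma degsumE : degsum = r%:R * (nedges G)%:R.
Proof.
rewrite -natr_sum -natrM; congr _%:R.
rewrite mulnC /nedges -sum_nat_const.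
transitivity (\sum_v \sum_(e in edges G) (v \in e : nat))%N.
  apply: eq_bigr => v _; rewrite /degree -sum1_card big_mkcond [RHS]big_mkcond.
  by apply: eq_bigr => e _; rewrite inE sub1set; case: (e \in _); case: (v \in e).
rewrite exchange_big /=; apply: eq_bigr => e eG.
by rewrite -(card_edge eG) -sum1_card [RHS]big_mkcond /=; apply: eq_bigr => v _.
Qed.

Lemma degsum_gt0 : 0 < degsum.
Proof. by rewrite degsumE mulr_gt0 ?ltr0n. Qed.

Lemma n_gt0 : (0 < n)%N.
Proof.
have /set0Pn[e eG] : edges G != set0 by rewrite -card_gt0.
have : #|e| != 0%N by rewrite card_edge // -lt0n.
by case: (n) e {eG} => // e; rewrite (_ : e = set0) ?cards0 //; apply/setP => -[].
Qed.

Lemma avgE : n%:R * avg_degree R G = degsum.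
Proof.
rewrite /avg_degree GV cardsT card_ord mulrC divfK ?pnatr_eq0 -?lt0n ?n_gt0 //.
by apply: eq_bigl => v; rewrite inE.
Qed.

Lemma avg_gt0 : 0 < avg_degree R G.
Proof. by rewrite -(pmulr_rgt0 _ (_ : 0 < n%:R)) ?ltr0n ?n_gt0 // avgE degsum_gt0. Qed.

Lemma lcodeg_top F j u : lcodeg F r j u = codegree G j u.
Proof.
rewrite /lcodeg /codegree; apply: eq_big => [sigma|sigma _].
  by rewrite GV subsetT.
by rewrite level_top ldeg_top.
Qed.

(** The exponent ['C(s, 2)] grows by [s] when [s] becomes [s + 1], which matches the factor [2 ^ s] lost in
[codweight_step]; for [s = r] the left-hand side is the codegree function of [G], up to
the factor [degsum]. *)
Lemma codweight_bound F s : (s <= r)%N -> (1 < s)%N ->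
  2 ^+ 'C(s, 2).-1 * codweight F s <= zeta * tau ^+ (r - s) * degsum.
Proof.
move: s; apply: level_ind => [lt1r|s lt_sr IH lt1s].
  move: G_delta; rewrite /codegree_fun avg_gt0 subnn expr0 mulr1.
  rewrite -ler_pdivrMr ?degsum_gt0 //; apply: le_trans.
  rewrite -mulrA ler_wpM2l ?exprn_ge0 // /codweight mulr_suml; apply: ler_sum => j _.
  have -> : codsum F r j = \sum_(v in vset G) (codegree G j v)%:R.
    by apply: eq_big => [u|u _]; rewrite ?GV ?inE // lcodeg_top.
  rewrite /delta_j GV cardsT card_ord -[tau ^+ _ * _ * _]mulrA avgE invfM.
  by rewrite le_eqVlt; apply/orP; left; apply/eqP; ring.
have C0 : (0 < 'C(s, 2))%N by rewrite bin_gt0.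
have := IH (ltnW lt1s); rewrite binS bin1.
have -> : ('C(s, 2) + s).-1 = ('C(s, 2).-1 + s)%N by lia.
have -> : (r - s = (r - s.+1).+1)%N by lia.
move=> leI.
have := ler_wpM2l (exprn_ge0 'C(s, 2).-1 (ler0n R 2)) (codweight_step F lt_sr).
move/le_trans; apply.
move: (ler_wpM2l (ltW tau_gt0) leI); rewrite exprD exprS => {}leI.
by apply: le_trans (le_trans leI _); rewrite le_eqVlt; apply/orP; left; apply/eqP; ring.
Qed.

Lemma overshoot_sum F s : (0 < s <= r)%N ->
  2 ^+ 'C(s.+1, 2).-1 * (\sum_u (overshoot F s u)%:R)
    <= zeta * tau ^+ (r - s) * degsum.
Proof.
case/andP=> s0; rewrite leq_eqVlt /overshoot => /orP[/eqP->|lt_sr].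
  rewrite ltnn big1 // mulr0 subnn !mulr_ge0 //; first exact: ltW.
  exact: ltW degsum_gt0.
rewrite lt_sr.
have := codweight_bound F lt_sr s0 => /(ler_wpM2l (ltW tau_gt0)).
have -> : (r - s = (r - s.+1).+1)%N by lia.
move=> le; apply: le_trans (le_trans le _); last first.
  by rewrite exprS le_eqVlt; apply/orP; left; apply/eqP; ring.
rewrite mulrCA ler_wpM2l ?exprn_ge0 // /codweight big_nat_recl //= bin_small // expr0 invr1 mul1r expr1.
rewrite mulrDr mulrA mulfV ?gt_eqF // mul1r lerDl.
apply: mulr_ge0 (ltW tau_gt0) _; apply: sumr_ge0 => j _.
by rewrite !mulr_ge0 ?invr_ge0 ?exprn_ge0 ?codsum_ge0 // ltW.
Qed.

End Codegrees.

(** * Size of the fingerprint *)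

Section Fingerprint.
Variables (R : realType) (n r : nat) (G : hypergraph 'I_n r) (tau zeta : R).
Hypotheses (tau_gt0 : 0 < tau) (zeta_gt0 : 0 < zeta).
Hypotheses (GV : vset G = [set: 'I_n]) (G_edge : (0 < nedges G)%N) (r_gt0 : (0 < r)%N).
Implicit Types (E A : {set {set 'I_n}}) (e sigma S I : {set 'I_n}) (v u : 'I_n).
Implicit Types (F : nat -> {set 'I_n}) (s k : nat).

Local Notation level := (level G tau zeta).
Local Notation picked := (picked G tau zeta).
Local Notation d v := ((degree G [set v])%:R : R).
Local Notation degsum := (\sum_v (degree G [set v])%:R : R).
Local Notation mu := (degree_measure R G).

Lemma leq_card_bigcup (I T : finType) (P : pred I) (B : I -> {set T}) :
  (#|\bigcup_(i | P i) B i| <= \sum_(i | P i) #|B i|)%N.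
Proof.
elim/big_rec2: _ => [|i m W _ leW]; first by rewrite cards0.
by apply: leq_trans (leq_card_setU _ _) _; exact: leq_add.
Qed.

Lemma sum_ldeg_in s A S : (\sum_(u in S) ldeg s A [set u]
  = \sum_(e in A) #|suf s e :&: S|)%N.
Proof.
transitivity (\sum_(u in S) \sum_(e in A) (u \in suf s e : nat))%N.
  apply: eq_bigr => v _; rewrite /ldeg -sum1_card big_mkcond [RHS]big_mkcond.
  by apply: eq_bigr => e _; rewrite inE sub1set; case: (e \in _); case: (v \in _).
rewrite exchange_big /=; apply: eq_bigr => e _.
rewrite -sum1_card big_mkcond [RHS]big_mkcond /=; apply: eq_bigr => u _.
by rewrite in_setI; case: (u \in S); case: (u \in suf s e).
Qed.

Lemma sum_ldeg s A : A \subset edges G -> (s <= r)%N ->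
  (\sum_v ldeg s A [set v] = s * #|A|)%N.
Proof.
move=> sAG le_sr; rewrite mulnC -sum_nat_const.
transitivity (\sum_(v in [set: 'I_n]) ldeg s A [set v])%N.
  by apply: eq_bigl => v; rewrite in_setT.
rewrite sum_ldeg_in; apply: eq_bigr => e eA.
by rewrite setIT card_suf // (card_edge (subsetP sAG _ eA)).
Qed.

Lemma demand_ge0 s v : 0 <= demand G tau zeta s v.
Proof. by rewrite /demand !mulr_ge0 ?exprn_ge0 //; case: s => *; rewrite ?ler01 ?ltW. Qed.

(** Each picked vertex contributes its own fresh edges: an edge of level [s] has a
single lead vertex. *)
Lemma sum_demand_picked F s : (s < r)%N ->
  \sum_(v in picked F s) demand G tau zeta s v <= #|level F s|%:R.
Proof.
move=> lt_sr.
apply: le_trans (_ : (\sum_(v in picked F s) #|[set e in level F s | v \in lead s e]|)%:R <= _).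
  rewrite natr_sum; apply: ler_sum => v vp; move: (vp); rewrite !inE.
  case/and3P=> _ _ /le_trans; apply; rewrite ler_nat; apply: subset_leq_card.
  exact: fresh_level lt_sr vp.
rewrite ler_nat.
apply: leq_trans (_ : (\sum_v #|[set e in level F s | v \in lead s e]| <= _)%N).
  by rewrite big_mkcond /=; apply: leq_sum => v _; case: ifP.
rewrite (eq_bigr (fun v => (\sum_(e in level F s) (v \in lead s e : nat))%N)).
  rewrite exchange_big /= -sum1_card; apply: leq_sum => e eL.
  have er : #|e| = r by apply: card_edge; apply: subsetP eL; exact/level_edges/ltnW.
  by rewrite -(@card_lead _ s e) ?er // -[leqRHS]sum1_card big_mkcond /= [leqRHS]big_mkcond.
move=> v _; rewrite -sum1_card big_mkcond [RHS]big_mkcond.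
by apply: eq_bigr => e _; rewrite inE; case: (e \in _); case: (v \in _).
Qed.

Lemma measureE S : mu S = (\sum_(u in S) d u) / degsum.
Proof. by rewrite /degree_measure {1}GV cardsT card_ord avgE. Qed.

Lemma measure_le S (a : R) : (mu S <= a) = (\sum_(u in S) d u <= a * degsum).
Proof. by rewrite measureE ler_pdivrMr ?degsum_gt0. Qed.

Lemma measure_setT : mu [set: 'I_n] = 1.
Proof.
rewrite measureE (eq_bigl xpredT) => [|u]; last by rewrite inE.
by rewrite divff // gt_eqF ?degsum_gt0.
Qed.

Lemma measureU S S' : mu (S :|: S') <= mu S + mu S'.
Proof.
rewrite !measureE -mulrDl ler_wpM2r ?invr_ge0 ?(ltW (degsum_gt0 _ _ _)) //.
rewrite [\sum_(u in S) _]big_mkcond [\sum_(u in S') _]big_mkcond -big_split /=.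
rewrite big_mkcond /=; apply: ler_sum => u _; rewrite inE.
by case: (u \in S); case: (u \in S'); rewrite /= ?addr0 ?add0r // lerDl.
Qed.

Lemma measureC S : mu (~: S) = 1 - mu S.
Proof.
apply/eqP; rewrite eq_sym subr_eq -measure_setT !measureE -mulrDl; apply/eqP.
congr (_ / _); rewrite addrC (bigID (mem S)) /=.
by congr (_ + _); apply: eq_bigl => u; rewrite !inE.
Qed.

Lemma card_heavy S (a : R) : {subset S <= heavy G zeta} -> mu S <= a ->
  #|S|%:R <= a * n%:R / zeta.
Proof.
move=> hS; rewrite measure_le => leS; rewrite ler_pdivlMr //.
have n0 : 0 < n%:R :> R by rewrite ltr0n (n_gt0 G_edge).
have avg0 := avg_gt0 R GV G_edge r_gt0.
rewrite -(ler_pM2r avg0) -!mulrA avgE //; apply: le_trans leS.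
rewrite -sumr_const mulr_suml; apply: ler_sum => v vS; rewrite mul1r.
exact/ltW/hS.
Qed.

Lemma picked_heavy F s : {subset picked F s <= heavy G zeta}.
Proof. by move=> v; rewrite !inE => /and3P[]. Qed.

(** Each vertex of [e] outside [suf s e] is the lead vertex of [e] at some level
[t >= s], and [e] entered that level because this vertex was picked. *)
Lemma level_out F s e : (s <= r)%N -> e \in level F s ->
  e :\: suf s e \subset \bigcup_(t < r) picked F t.
Proof.
move: s; apply: level_ind => [|s lt_sr IH] eL.
  by rewrite level_top in eL; rewrite suf_full ?setDv ?sub0set // (card_edge eL).
have [v [vp vl eL']] := mem_level lt_sr eL.
apply/subsetP => u; rewrite inE => /andP[uNs ue].
have [us|uNs1] := boolP (u \in suf s.+1 e); last first.
  by apply: (subsetP (IH eL')); rewrite inE uNs1.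
have er : #|e| = r by apply: card_edge; apply: subsetP eL; exact/level_edges/ltnW.
have /card1P[w lw] : #|lead s e| == 1%N by rewrite card_lead ?er.
have -> : u = v.
  have : u \in lead s e by rewrite inE uNs us.
  by move: vl; rewrite !lw !inE => /eqP-> /eqP.
by apply/bigcupP; exists (Ordinal lt_sr).
Qed.

Lemma bottom_sub F e : e \in level F 0 -> e \subset \bigcup_(t < r) picked F t.
Proof. by move=> /(level_out (leq0n r)); rewrite suf0 setD0. Qed.

Lemma sum_demand0 F : tau ^+ r.-1 * \sum_(v in picked F 0) d v
  <= #|level F 0|%:R.
Proof.
apply: le_trans (sum_demand_picked F r_gt0); rewrite mulr_sumr.
by apply: ler_sum => v _; rewrite /demand mul1r subn1.
Qed.

Lemma bottom_induced F S : (forall t, (t < r)%N -> picked F t \subset S) ->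
  level F 0 \subset edges (induced G S).
Proof.
move=> sFS; apply/subsetP => e eL; rewrite inE.
rewrite (subsetP (level_edges G tau zeta F (leq0n r)) _ eL) /=.
apply: subset_trans (bottom_sub eL) _; apply/bigcupsP => t _; exact: sFS.
Qed.

Lemma nedges_avg : (nedges G)%:R / n%:R = avg_degree R G / r%:R.
Proof.
have r0 : r%:R != 0 :> R by rewrite pnatr_eq0 -lt0n.
have n0 : n%:R != 0 :> R by rewrite pnatr_eq0 -lt0n (n_gt0 G_edge).
apply: (mulIf r0); rewrite divfK // mulrAC [_ * r%:R]mulrC -degsumE.
by rewrite -avgE // mulrAC divff // mul1r.
Qed.

Lemma bottom_sparse F I : (forall s, F s \subset I) ->
  is_degenerate (Num.floor (tau ^+ r.-1 * zeta * (nedges G)%:R / n%:R)) (induced G I) ->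
  #|level F 0|%:R <= tau ^+ r.-1 * zeta * (avg_degree R G / r%:R)
                       * #|\bigcup_(t < r) picked F t|%:R.
Proof.
move=> sFI degen; set U := \bigcup_(t < r) _.
have sUI : U \subset I.
  by apply/bigcupsP => t _; apply: subset_trans (subsetIl _ _) (sFI _).
have /degen : U \subset vset (induced G I) by rewrite /= GV setTI.
set b := Num.floor _; rewrite -(ler_int R) rmorphM /= => leU.
apply: le_trans (_ : (nedges (induced (induced G I) U))%:R <= _).
  rewrite ler_nat; apply: subset_leq_card; apply/subsetP => e eL.
  have := bottom_sub eL; rewrite !inE -/U => eU; rewrite eU (subset_trans eU sUI).
  by rewrite (subsetP (level_edges G tau zeta F (leq0n r))).
apply: le_trans leU _; rewrite ler_wpM2r // -nedges_avg mulrA; exact: floor_le.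
Qed.

(** If there were too many picked vertices at level [0], the union of all the picked
sets would be at most [r] times larger than [picked F 0], and the edges ending
in [picked F 0] would make the subhypergraph induced on it too dense. *)
Lemma card_picked0 F I : (forall s, F s \subset I) ->
  (forall s, (0 < s < r)%N -> #|picked F s|%:R <= 2 * tau * n%:R / zeta ^+ 2) ->
  is_degenerate (Num.floor (tau ^+ r.-1 * zeta * (nedges G)%:R / n%:R)) (induced G I) ->
  #|picked F 0|%:R <= 2 * tau * n%:R / zeta ^+ 2
  /\ #|\bigcup_(t < r) picked F t|%:R <= r%:R * (2 * tau * n%:R / zeta ^+ 2).
Proof.
set L := 2 * tau * n%:R / zeta ^+ 2 => sFI leL /(bottom_sparse sFI).
set U := \bigcup_(t < r) _ => sparse.
have L_ge0 : 0 <= L by rewrite !mulr_ge0 ?invr_ge0 ?exprn_ge0 // ltW.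
have leU : #|U|%:R <= #|picked F 0|%:R + r.-1%:R * L.
  apply: le_trans (_ : \sum_(t < r) #|picked F t|%:R <= _).
    by rewrite -natr_sum ler_nat leq_card_bigcup.
  rewrite -(big_mkord xpredT (fun t => #|picked F t|%:R)) big_ltn // lerD2l.
  apply: le_trans (_ : \sum_(1 <= t < r) L <= _); last first.
    by rewrite sumr_const_nat subn1 mulr_natl.
  by rewrite !big_seq; apply: ler_sum => t; rewrite mem_index_iota; exact: leL.
have rE : r%:R = r.-1%:R + 1 :> R by rewrite natr1 prednK.
suff le0 : #|picked F 0|%:R <= L.
  by split=> //; apply: le_trans leU _; rewrite rE mulrDl mul1r addrC lerD2l.
rewrite leNgt; apply/negP => ltL.
have leU' : #|U|%:R <= r%:R * #|picked F 0|%:R :> R.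
  apply: le_trans leU _; rewrite rE mulrDl mul1r addrC lerD2r ler_wpM2l //.
  exact: ltW.
have [v0 v0P] : exists v, v \in picked F 0.
  by apply/set0Pn; rewrite -card_gt0 -(ltr0n R); apply: le_lt_trans ltL.
have many : zeta * avg_degree R G * #|picked F 0|%:R < \sum_(v in picked F 0) d v.
  rewrite mulr_natr -sumr_const; apply: ltr_sum => [|v vP].
    by apply/hasP; exists v0; rewrite ?mem_index_enum.
  exact: picked_heavy vP.
have t0 : 0 < tau ^+ r.-1 by rewrite exprn_gt0.
have r0 : r%:R != 0 :> R by rewrite pnatr_eq0 -lt0n.
have c_ge0 : 0 <= tau ^+ r.-1 * zeta * (avg_degree R G / r%:R).
  apply: mulr_ge0; first by rewrite mulr_ge0 ?exprn_ge0 // ltW.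
  by rewrite divr_ge0 // (ltW (avg_gt0 R GV G_edge r_gt0)).
have := le_trans (sum_demand0 F) (le_trans sparse (ler_wpM2l c_ge0 leU')).
have -> : tau ^+ r.-1 * zeta * (avg_degree R G / r%:R) * (r%:R * #|picked F 0|%:R)
    = tau ^+ r.-1 * (zeta * avg_degree R G * #|picked F 0|%:R) by field.
by rewrite ler_pM2l // leNgt many.
Qed.

Lemma measure_picked0 F I : (forall s, F s \subset I) ->
  (forall s, (0 < s < r)%N -> #|picked F s|%:R <= 2 * tau * n%:R / zeta ^+ 2) ->
  is_degenerate (Num.floor (tau ^+ r.-1 * zeta * (nedges G)%:R / n%:R)) (induced G I) \/
  (nedges (induced G I))%:R <= 2 * r%:R * tau ^+ r * (nedges G)%:R / zeta ->
  mu (picked F 0) <= 2 * tau / zeta.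
Proof.
move=> sFI leL hI; rewrite measure_le -(@ler_pM2l _ (tau ^+ r.-1)) ?exprn_gt0 //.
apply: le_trans (sum_demand0 F) _.
have r0 : r%:R != 0 :> R by rewrite pnatr_eq0 -lt0n.
have n0 : n%:R != 0 :> R by rewrite pnatr_eq0 -lt0n (n_gt0 G_edge).
have z0 : zeta != 0 by rewrite gt_eqF.
case: hI => [degen|few].
  have [_ leU] := card_picked0 sFI leL degen.
  apply: le_trans (bottom_sparse sFI degen) _.
  have c_ge0 : 0 <= tau ^+ r.-1 * zeta * (avg_degree R G / r%:R).
    apply: mulr_ge0; first by rewrite mulr_ge0 ?exprn_ge0 // ltW.
    by rewrite divr_ge0 // (ltW (avg_gt0 R GV G_edge r_gt0)).
  apply: le_trans (ler_wpM2l c_ge0 leU) _.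
  by rewrite -avgE // le_eqVlt; apply/orP; left; apply/eqP; field; rewrite r0 z0.
apply: le_trans (le_trans _ few) _.
  rewrite ler_nat; apply: subset_leq_card; apply: bottom_induced => t _.
  exact: subset_trans (subsetIl _ _) (sFI t).
have -> : tau ^+ r = tau * tau ^+ r.-1 by rewrite -exprS prednK.
rewrite degsumE //.
by rewrite le_eqVlt; apply/orP; left; apply/eqP; field.
Qed.

(** The edges collected for the picked vertices are all counted by the degrees of
level [s], which are capped. *)
Lemma measure_picked F s : codegree_fun G tau <= zeta -> zeta <= 1 ->
  (0 < s < r)%N -> mu (picked F s) <= 2 * tau / zeta.
Proof.
move=> G_delta zeta_le1 /andP[s0 lt_sr]; rewrite measure_le.
have t0 : 0 < tau ^+ (r - s.+1) by rewrite exprn_gt0.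
have few : #|level F s|%:R <= 2 * tau ^+ (r - s) * degsum.
  apply: le_trans (_ : (s * #|level F s|)%:R <= _).
    by rewrite ler_nat -{1}(mul1n #|_|) leq_mul2r s0 orbT.
  rewrite -sum_ldeg ?(ltnW lt_sr) ?level_edges ?(ltnW lt_sr) // natr_sum.
  apply: le_trans (_ : \sum_u (tau ^+ (r - s) * d u
                                 + (overshoot G tau zeta F s u)%:R) <= _).
    by apply: ler_sum => u _; apply: ldeg_vertex (ltnW lt_sr).
  rewrite big_split /= -mulr_sumr -mulrA -[2]/(1 + 1) mulrDl !mul1r lerD2l.
  have s_in : (0 < s <= r)%N by rewrite s0 ltnW.
  have over := overshoot_sum tau_gt0 GV G_edge r_gt0 zeta_gt0 G_delta F s_in.
  have c1 : 1 <= 2 ^+ 'C(s.+1, 2).-1 :> R by rewrite exprn_ege1 // ler1n.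
  apply: le_trans (ler_peMl (sumr_ge0 _ _) c1) (le_trans over _) => //.
  rewrite -mulrA ler_piMl // mulr_ge0 ?exprn_ge0 ?(ltW tau_gt0) //.
  exact/ltW/degsum_gt0.
rewrite -(@ler_pM2l _ (zeta * tau ^+ (r - s.+1))) ?mulr_gt0 //.
have -> : zeta * tau ^+ (r - s.+1) * \sum_(u in picked F s) d u
    = \sum_(u in picked F s) demand G tau zeta s u.
  by rewrite mulr_sumr; apply: eq_bigr => v _; rewrite /demand; case: s s0 {few lt_sr t0}.
apply: le_trans (le_trans (sum_demand_picked F lt_sr) few) _.
have -> : (r - s = (r - s.+1).+1)%N by lia.
rewrite exprS le_eqVlt; apply/orP; left; apply/eqP; field.
by rewrite gt_eqF.
Qed.

End Fingerprint.

(** * Size of the container *)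

Section Container.
Variables (R : realType) (n r : nat) (G : hypergraph 'I_n r) (tau zeta : R).
Hypotheses (tau_gt0 : 0 < tau) (zeta_gt0 : 0 < zeta).
Hypotheses (GV : vset G = [set: 'I_n]) (G_edge : (0 < nedges G)%N) (r_gt0 : (0 < r)%N).
Implicit Types (E A : {set {set 'I_n}}) (e sigma S U : {set 'I_n}) (v u : 'I_n).
Implicit Types (F : nat -> {set 'I_n}) (s k : nat).

Local Notation level := (level G tau zeta).
Local Notation before := (before G tau zeta).
Local Notation picked := (picked G tau zeta).
Local Notation hits := (hits G tau zeta).
Local Notation overshoot := (overshoot G tau zeta).
Local Notation d v := ((degree G [set v])%:R : R).
Local Notation degsum := (\sum_v (degree G [set v])%:R : R).
Local Notation mu := (degree_measure R G).

(** What lies outside the container is covered, and the rest of [covered F] consists of the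
picked vertices and of vertices of low degree, both of small measure. Adding these makes
every vertex outside fail the demand at every level. *)
Definition covered F : {set 'I_n} :=
  [set v | ~~ heavy G zeta v] :|: \bigcup_(s < r) hits F s.

Definition saturated F s : {set 'I_n} :=
  [set u | tau ^+ (r - s) * d u <= (ldeg s (level F s) [set u])%:R].

Definition through s A sigma : {set {set 'I_n}} :=
  [set e in A | sigma \subset suf s e].

Lemma card_subsets_ge2 s U : (#|U| <= s)%N ->
  (#|[set sigma : {set 'I_n} | (sigma \subset U) && (1 < #|sigma|)%N]| <= 2 ^ s.-1 * #|U|)%N.
Proof.
move=> le_Us; have [le_U1|lt1U] := leqP #|U| 1.
  rewrite (_ : [set _ | _] = set0) ?cards0 //; apply/setP => sigma; rewrite !inE.
  apply/negP => /andP[/subset_leq_card le_sU].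
  by rewrite ltnNge (leq_trans le_sU le_U1).
apply: leq_trans (_ : 2 ^ #|U| <= _)%N.
  rewrite -card_powerset; apply/subset_leq_card/subsetP => sigma.
  by rewrite !inE => /andP[].
apply: leq_trans (_ : 2 ^ s.-1 * 2 <= _)%N; last by rewrite leq_mul2l lt1U orbT.
by rewrite -expnSr leq_exp2l //; lia.
Qed.

Lemma sum_ldeg_ge2 s A S : A \subset edges G -> (s <= r)%N ->
  (\sum_(sigma : {set 'I_n} | (sigma \subset S) && (1 < #|sigma|)) ldeg s A sigma
    <= 2 ^ s.-1 * \sum_(u in S) ldeg s A [set u])%N.
Proof.
move=> sAG le_sr; rewrite sum_ldeg_in.
rewrite (eq_bigr (fun sigma : {set 'I_n} => (\sum_(e in A) (sigma \subset suf s e : nat))%N)).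
  rewrite exchange_big big_distrr /=; apply: leq_sum => e eA.
  have le_s : (#|suf s e :&: S| <= s)%N.
    rewrite -[leqRHS](@card_suf _ s e) ?(card_edge (subsetP sAG _ eA)) //.
    exact/subset_leq_card/subsetIl.
  apply: leq_trans (card_subsets_ge2 le_s).
  rewrite -sum1_card big_mkcond [leqRHS]big_mkcond /=; apply: leq_sum => sigma _.
  by rewrite inE subsetI; case: (sigma \subset S); case: (sigma \subset suf s e); case: ltnP.
move=> sigma _; rewrite /ldeg -sum1_card big_mkcond [RHS]big_mkcond.
by apply: eq_bigr => e _; rewrite inE; case: (e \in _); case: (sigma \subset _).
Qed.

Lemma card_fresh0 F v :
  #|fresh G tau 0 (level F 1) (before F 0 v) v| = ldeg 1 (level F 1) [set v].
Proof.
apply: eq_card => e; rewrite inE [in RHS]inE sub1set /lead suf0 setD0.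
suff -> : blocked G tau 0 (level F 1) (before F 0 v) e = false by rewrite andbT.
apply: negbTE; apply/existsP => -[sigma /and3P[]]; rewrite suf0 subset0 => /eqP->.
by rewrite eqxx.
Qed.

(** At level [0] being hit only asks for saturation at level [1]. *)
Lemma saturated_covered F : saturated F 1 \subset covered F.
Proof.
apply/subsetP => u; rewrite !inE => sat; rewrite -implybE; apply/implyP => hv.
apply/bigcupP; exists (Ordinal r_gt0) => //; rewrite inE /hit hv /=.
by rewrite card_fresh0 /demand mul1r.
Qed.

Lemma notin_covered F v s : v \notin covered F -> (s < r)%N ->
  #|fresh G tau s (level F s.+1) (before F s v) v|%:R <= demand G tau zeta s v.
Proof.
move=> + lt_sr; rewrite !inE negb_or negbK => /andP[hv].
apply: contraR; rewrite -ltNge => lt; apply/bigcupP.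
by exists (Ordinal lt_sr) => //; rewrite inE /hit hv ltW.
Qed.

(** Away from [covered F], an edge is either fresh when its lead vertex is examined or
blocked, and a blocking set that contains no saturated vertex has at least two
elements. *)
Lemma level_cover F s : (0 < s < r)%N ->
  level F s.+1 \subset
    (\bigcup_(u in covered F) through s.+1 (level F s.+1) [set u])
    :|: (\bigcup_(v in ~: covered F) fresh G tau s (level F s.+1) (before F s v) v)
    :|: (\bigcup_(u in saturated F s :\: covered F) through s.+1 (level F s.+1) [set u])
    :|: (\bigcup_(sigma : {set 'I_n} |
          [&& sigma \subset ~: (saturated F s :|: covered F), (1 < #|sigma| <= s)%N
            & 2 ^+ s.-1 * tau * (ldeg s.+1 (level F s.+1) sigma)%:R
                <= (ldeg s (level F s) sigma)%:R]) through s.+1 (level F s.+1) sigma).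
Proof.
set X := covered F; set D := saturated F s; set E := level F s.+1.
move=> /andP[s_gt0 lt_sr]; apply/subsetP => e eE; rewrite !in_setU -!orbA.
have er : #|e| = r by apply: card_edge (subsetP (level_edges G tau zeta F lt_sr) _ eE).
case: (boolP (e \in \bigcup_(u in X) _)) => //= eNX.
have offX u : u \in suf s.+1 e -> u \notin X.
  move=> us; apply: contra eNX => uX; apply/bigcupP; exists u => //.
  by rewrite inE eE sub1set.
have /card1P[v lv] : #|lead s e| == 1%N by rewrite card_lead ?er.
have vl : v \in lead s e by rewrite lv inE.
have vs : v \in suf s.+1 e by move: vl; rewrite inE => /andP[].
case: (boolP (blocked G tau s E (before F s v) e)) => [|nb]; last first.
  apply/orP; left; apply/bigcupP; exists v; first by rewrite inE offX.
  by rewrite inE eE vl nb.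
rewrite /blocked => /existsP[sigma /and3P[sub sigma0 le_cap]]; apply/orP; right.
have {}le_cap : cap G tau s E sigma <= (ldeg s (level F s) sigma)%:R.
  by apply: le_trans le_cap _; rewrite ler_nat ldeg_mono // before_sub.
have sub1 : sigma \subset suf s.+1 e := subset_trans sub (sufS s e).
case: (boolP [disjoint sigma & D]) => [dis|]; last first.
  case/pred0Pn=> u /andP[/= us uD]; apply/orP; left; apply/bigcupP.
  have us1 := subsetP sub1 _ us; exists u; first by rewrite inE uD offX.
  by rewrite inE eE sub1set.
have sigma_gt1 : (1 < #|sigma|)%N.
  rewrite ltn_neqAle eq_sym card_gt0 sigma0 andbT; apply/negP => /cards1P[u su].
  move: le_cap; rewrite /cap su cards1 eqxx => uD.
  by have := disjointFr dis (_ : u \in sigma); rewrite su !inE uD => /(_ (eqxx u)).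
apply/orP; right; apply/bigcupP; exists sigma; last by rewrite inE eE.
rewrite sigma_gt1 /=; apply/and3P; split.
- rewrite setCU subsetI -disjoints_subset dis.
  by apply/subsetP => u /(subsetP sub1) us; rewrite inE offX.
- by rewrite -[leqRHS](@card_suf _ s e) ?er ?subset_leq_card // ltnW.
- by move: le_cap; rewrite /cap gtn_eqF.
Qed.

(** The edges through [covered F] and the fresh edges give the first two terms. Blocking is
charged to the degrees of level [s] outside [covered F]: up to the overshoot, the degree
of a saturated vertex is at most [1 / tau] times larger one level up, and the blocking
sets of at least two vertices are paid by the vertices that are not saturated, so no
degree is charged twice. At level [1] there is nothing to charge: saturated vertices are
covered and suffixes are too short to contain a larger blocking set. *)
Lemma level_bound F s : (0 < s < r)%N ->
  tau * #|level F s.+1|%:R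
    <= tau * (\sum_(u in covered F) (ldeg s.+1 (level F s.+1) [set u])%:R)
     + zeta * tau ^+ (r - s) * degsum
     + tau * (\sum_(u in ~: covered F) (overshoot F s.+1 u)%:R)
     + (if s == 1%N then 0
        else \sum_(u in ~: covered F) (ldeg s (level F s) [set u])%:R).
Proof.
move=> s_in; case/andP: (s_in) => s_gt0 lt_sr.
set X := covered F; set D := saturated F s; set E := level F s.+1.
have := level_cover F s_in; rewrite -/X -/D -/E => /subset_leq_card.
set A1 := \bigcup_(u in X) _; set A2 := \bigcup_(v in _) fresh _ _ _ _ _ _.
set A3 := \bigcup_(u in _) _; set A4 := \bigcup_(sigma | _) _ => leE.
have {}leE : #|E|%:R <= #|A1|%:R + #|A2|%:R + #|A3|%:R + #|A4|%:R :> R.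
  rewrite -!natrD ler_nat; apply: leq_trans leE _.
  apply: leq_trans (leq_card_setU _ _) _; rewrite leq_add2r.
  apply: leq_trans (leq_card_setU _ _) _; rewrite leq_add2r.
  exact: leq_card_setU.
have tE : tau ^+ (r - s) = tau * tau ^+ (r - s.+1).
  by rewrite -exprS; congr (_ ^+ _); lia.
have le1 : #|A1|%:R <= \sum_(u in X) (ldeg s.+1 E [set u])%:R :> R.
  by rewrite -natr_sum ler_nat leq_card_bigcup.
have le2 : tau * #|A2|%:R <= zeta * tau ^+ (r - s) * degsum.
  rewrite tE mulrCA -mulrA ler_pM2l //.
  apply: le_trans (_ : \sum_(v in ~: X) demand G tau zeta s v <= _).
    apply: le_trans (_ : (\sum_(v in ~: X) #|fresh G tau s E (before F s v) v|)%:R <= _).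
      by rewrite ler_nat leq_card_bigcup.
    rewrite natr_sum; apply: ler_sum => v; rewrite inE => vX.
    exact: notin_covered.
  rewrite mulr_sumr big_mkcond /=; apply: ler_sum => v _.
  have dE : demand G tau zeta s v = zeta * tau ^+ (r - s.+1) * d v.
    by rewrite /demand; case: s s_gt0 {s_in lt_sr D E A1 A2 A3 A4 leE tE le1}.
  by case: ifP => _; [rewrite dE | rewrite -dE; exact: demand_ge0].
have le3 : tau * #|A3|%:R <= \sum_(u in D :\: X) (ldeg s (level F s) [set u])%:R
    + tau * \sum_(u in ~: X) (overshoot F s.+1 u)%:R.
  apply: le_trans (_ : tau * (\sum_(u in D :\: X) (ldeg s.+1 E [set u])%:R) <= _).
    by rewrite ler_pM2l // -natr_sum ler_nat leq_card_bigcup.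
  apply: le_trans (_ : tau * (\sum_(u in D :\: X)
      (tau ^+ (r - s.+1) * d u + (overshoot F s.+1 u)%:R)) <= _).
    by rewrite ler_pM2l //; apply: ler_sum => u _; exact: ldeg_vertex.
  rewrite big_split /= mulrDr; apply: lerD.
    rewrite -mulr_sumr mulrA -tE mulr_sumr; apply: ler_sum => u.
    by rewrite !inE => /andP[].
  rewrite ler_pM2l // big_mkcond [leRHS]big_mkcond /=; apply: ler_sum => u _.
  by rewrite in_setD in_setC; case: (u \in X); case: (u \in D).
have le4 : tau * #|A4|%:R
    <= \sum_(u in ~: (D :|: X)) (ldeg s (level F s) [set u])%:R.
  have p0 : 0 < 2 ^+ s.-1 :> R by rewrite exprn_gt0.
  rewrite -(ler_pM2l p0).
  apply: le_trans (_ : \sum_(sigma : {set 'I_n} |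
      (sigma \subset ~: (D :|: X)) && (1 < #|sigma|)%N) (ldeg s (level F s) sigma)%:R <= _).
    apply: le_trans (_ : 2 ^+ s.-1 * (tau * (\sum_(sigma : {set 'I_n} |
        [&& sigma \subset ~: (D :|: X), (1 < #|sigma| <= s)%N
          & 2 ^+ s.-1 * tau * (ldeg s.+1 E sigma)%:R
              <= (ldeg s (level F s) sigma)%:R]) (ldeg s.+1 E sigma)%:R)) <= _).
      by rewrite ler_pM2l // ler_pM2l // -natr_sum ler_nat leq_card_bigcup.
    rewrite mulrA mulr_sumr big_mkcond [leRHS]big_mkcond /=; apply: ler_sum => sigma _.
    by case: (sigma \subset _) => //=; case: (1 < _)%N => //=; case: (_ <= s)%N => //=; case: ifP.
  rewrite -!natr_sum -natrX -natrM ler_nat; apply: sum_ldeg_ge2; last exact: ltnW.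
  exact/level_edges/ltnW.
have fin : tau * #|A3|%:R + tau * #|A4|%:R
  <= tau * (\sum_(u in ~: X) (overshoot F s.+1 u)%:R)
     + (if s == 1%N then 0 else \sum_(u in ~: X) (ldeg s (level F s) [set u])%:R).
  have [s1|s_neq1] := eqVneq s 1%N.
    have -> : A4 = set0.
      by rewrite /A4 big_pred0 // => sigma; rewrite s1; case: ltngtP; rewrite ?andbF.
    have -> : A3 = set0.
      rewrite /A3 big_pred0 // => u; rewrite inE; apply/negP => /andP[uNX].
      by rewrite /D s1 => /(subsetP (saturated_covered F)); apply/negP.
    rewrite !cards0 !mulr0 !addr0 mulr_ge0 ?sumr_ge0 //; exact: ltW.
  apply: le_trans (lerD le3 le4) _; rewrite addrAC addrC lerD2l.
  rewrite big_mkcond [X in _ + X <= _]big_mkcond [leRHS]big_mkcond -big_split /=.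
  apply: ler_sum => u _; rewrite in_setD !in_setC [_ \in D :|: X]in_setU.
  by case: (u \in X); case: (u \in D); rewrite /= ?addr0 ?add0r.
have := ler_wpM2l (ltW tau_gt0) leE; rewrite !mulrDr => /le_trans; apply.
rewrite -!addrA; apply: lerD; first by rewrite ler_pM2l.
by apply: lerD.
Qed.

Hypotheses (G_delta : codegree_fun G tau <= zeta).

(** Write [q_s] for the degree sum of level [s] outside [X = covered F], divided by
[tau ^ (r - s) * degsum]. As the degree sum of level [s + 1] is [s + 1] times its number
of edges, [level_bound] reads [q_(s+1) <= s * mu X + (s + 1) * (3 / 2 * zeta + q_s)], and
the bounds with coefficients [s! - 1] and [2 * s! - 2] propagate through this recursion.
It may start from [0] in place of [q_1], because nothing is charged to level [1]. *)
Lemma uncovered_bound F s : (s < r)%N ->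
  (if s.+1 == 1%N then 0
   else \sum_(u in ~: covered F) (ldeg s.+1 (level F s.+1) [set u])%:R)
  <= ((s.+1`!%:R - 1) * mu (covered F)
        + (2 * s.+1`!%:R - 2) * (3 / 2 * zeta)) * (tau ^+ (r - s.+1) * degsum).
Proof.
elim: s => [|s IH] lt_sr.
  by rewrite (_ : 1`!%:R = 1) // subrr mul0r mulr1 subrr mul0r add0r mul0r.
have s_in : (0 < s.+1 < r)%N by [].
have := level_bound F s_in; have := IH (ltnW lt_sr).
set X := covered F; set x := mu X.
set Q := (if s.+1 == 1%N then _ else _).
have tE : tau ^+ (r - s.+1) = tau * tau ^+ (r - s.+2).
  by rewrite -exprS; congr (_ ^+ _); lia.
rewrite tE; set N := tau ^+ (r - s.+2) * degsum.
rewrite (_ : tau * _ * degsum = tau * N); last by rewrite /N mulrA.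
rewrite (_ : zeta * (tau * _) * degsum = tau * (zeta * N)); last by rewrite /N; ring.
set Y := \sum_(u in X) _; set O' := \sum_(u in ~: X) (overshoot _ _ _)%:R.
set Q' : R := \sum_(u in ~: X) _.
have sumE : s.+2%:R * #|level F s.+2|%:R = Y + Q'.
  rewrite -natrM -(sum_ldeg (G := G)) ?level_edges //.
  rewrite natr_sum (bigID (mem X)) /=; congr (_ + _).
  by apply: eq_bigl => u; rewrite in_setC.
pose OX : R := \sum_(u in X) (overshoot F s.+2 u)%:R.
have leY : Y <= x * N + OX.
  rewrite /x measureE // /N mulrCA mulfVK ?gt_eqF ?degsum_gt0 // mulr_sumr -big_split /=.
  by apply: ler_sum => u _; apply: ldeg_vertex.
have leO : OX + O' <= zeta / 2 * N.
  have -> : OX + O' = \sum_u (overshoot F s.+2 u)%:R.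
    rewrite [RHS](bigID (mem X)) /=; congr (_ + _).
    by apply: eq_bigl => u; rewrite in_setC.
  have s_in2 : (0 < s.+2 <= r)%N by [].
  have := overshoot_sum tau_gt0 GV G_edge r_gt0 zeta_gt0 G_delta F s_in2.
  rewrite -mulrA -/N => le2; rewrite mulrAC ler_pdivlMr // mulrC; apply: le_trans le2.
  rewrite ler_wpM2r ?sumr_ge0 //.
  rewrite -{1}[2]expr1 ler_eXn2l ?ltr1n // -ltnS prednK ?bin_gt0 //.
  by rewrite !binS !bin0; lia.
have N_ge0 : 0 <= N.
  by rewrite mulr_ge0 ?exprn_ge0 ?(ltW tau_gt0) // ltW // degsum_gt0.
have O'_ge0 : 0 <= O' by apply: sumr_ge0.
have OX_ge0 : 0 <= OX by apply: sumr_ge0.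
move=> leQ leE.
have {}leE : #|level F s.+2|%:R <= Y + zeta * N + O'
    + ((s.+1`!%:R - 1) * x + (2 * s.+1`!%:R - 2) * (3 / 2 * zeta)) * N.
  rewrite -(ler_pM2l tau_gt0); apply: le_trans leE _; rewrite !mulrDr !lerD2l.
  by apply: le_trans leQ _; rewrite le_eqVlt; apply/orP; left; apply/eqP; ring.
move: leE; rewrite -(ler_pM2l (_ : 0 < s.+2%:R)) ?ltr0n // sumE.
rewrite [in X in _ -> X]factS natrM; set f : R := s.+1`!%:R.
have -> : s.+2%:R = s.+1%:R + 1 :> R by rewrite natr1.
have s1 : 1 <= s.+1%:R :> R by rewrite ler1n.
have zN_ge0 : 0 <= zeta * N by rewrite mulr_ge0 // ltW.
move: (s.+1%:R : R) s1 => t t1 leE.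
have m1 : t * Y <= t * (x * N + OX) by rewrite ler_wpM2l //; lra.
have m2 : (t + 1) * (OX + O') <= (t + 1) * (zeta / 2 * N) by rewrite ler_wpM2l //; lra.
have m3 : 0 <= (t - 1) * (zeta * N) by rewrite mulr_ge0 // subr_ge0.
by rewrite (_ : (s.+2 == 1)%N = false) //; lra.
Qed.

(** At level [r] the normalised degree sum outside [X] is [1 - mu X], so the recursion
becomes an inequality for [mu X]. *)
Lemma measure_covered F : r`!%:R^-1 <= mu (covered F) + 3 * zeta.
Proof.
case: (ltnP 1 r) => [lt1r|le_r1]; last first.
  have r1 : r = 1%N by lia.
  have -> : covered F = [set: 'I_n].
    apply/setP => u; rewrite in_setT; apply: (subsetP (saturated_covered F)).
    have top s : s = r -> ldeg s (level F s) [set u] = degree G [set u].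
      by move->; rewrite level_top ldeg_top.
    by rewrite inE top // (_ : (r - 1 = 0)%N) ?mul1r //; lia.
  by rewrite measure_setT // r1 (_ : 1`!%:R = 1) // invr1 lerDl mulr_ge0 // ltW.
have := uncovered_bound F (_ : (r.-1 < r)%N); rewrite prednK // leqnn => /(_ isT).
rewrite gtn_eqF // subnn expr0 mul1r.
under eq_bigr do rewrite level_top ldeg_top.
set x := mu (covered F); set f := r`!%:R.
have -> : \sum_(u in ~: covered F) d u = (1 - x) * degsum.
  by rewrite /x -measureC // measureE // mulfVK // gt_eqF ?degsum_gt0.
rewrite ler_pM2r ?degsum_gt0 // => le.
have f_gt0 : 0 < f by rewrite ltr0n fact_gt0.
rewrite -(ler_pM2l f_gt0) mulfV ?gt_eqF //; move: zeta_gt0; nra.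
Qed.

Lemma measure_light : mu [set v | ~~ heavy G zeta v] <= zeta.
Proof.
rewrite measure_le // -(avgE R GV G_edge r_gt0) mulrCA mulr_natl -[n in _ *+ n]card_ord.
rewrite -sumr_const big_mkcond /=; apply: ler_sum => u _.
rewrite inE /heavy -leNgt; case: ifP => // _.
by rewrite mulr_ge0 // ltW // (avg_gt0 R GV G_edge r_gt0).
Qed.

Lemma measure_container F : zeta <= 1 -> mu (picked F 0) <= 2 * tau / zeta ->
  mu (container G tau zeta F)
    <= 1 - r`!%:R^-1 + 4 * zeta + 2 * r%:R * tau / zeta.
Proof.
move=> zeta_le1 le0; set C := container _ _ _ _.
have sub : covered F \subset [set v | ~~ heavy G zeta v] :|: ~: C
    :|: \bigcup_(s < r) picked F s.
  apply/subsetP => v; rewrite [v \in covered F]inE !in_setU => /orP[->//|].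
  case/bigcupP=> s _ vh; have [vF|vNF] := boolP (v \in F s).
    apply/orP; right; apply/bigcupP; exists s => //; by rewrite inE vF.
  apply/orP; left; apply/orP; right; rewrite !inE; apply/negP => /forallP/(_ s).
  by rewrite vh (negbTE vNF).
have mono S S' : S \subset S' -> mu S <= mu S'.
  move=> sSS'; rewrite !measureE // ler_wpM2r ?invr_ge0 ?(ltW (degsum_gt0 _ _ _)) //.
  rewrite big_mkcond [leRHS]big_mkcond; apply: ler_sum => u _ /=.
  by case: ifP => [/(subsetP sSS')->//|_]; case: ifP.
have leP : mu (\bigcup_(s < r) picked F s) <= r%:R * (2 * tau / zeta).
  apply: le_trans (_ : \sum_(s < r) mu (picked F s) <= _).
    elim/big_rec2: _ => [|s m W _ leW]; first by rewrite measureE // big_set0 mul0r.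
    by apply: le_trans (measureU _ _ _ _ _ _) _; rewrite // lerD2l.
  rewrite mulr_natl -[X in _ *+ X]card_ord -sumr_const; apply: ler_sum => s _.
  case: (posnP s) => [->//|s_gt0]; apply: measure_picked => //.
  by rewrite s_gt0 ltn_ord.
have := le_trans (measure_covered F) (lerD (mono _ _ sub) (lexx _)).
have := measureU R GV G_edge r_gt0 ([set v | ~~ heavy G zeta v] :|: ~: C)
  (\bigcup_(s < r) picked F s).
have := measureU R GV G_edge r_gt0 [set v | ~~ heavy G zeta v] (~: C).
rewrite measureC //; have := measure_light.
have -> : 2 * r%:R * tau / zeta = r%:R * (2 * tau / zeta) by ring.
lra.
Qed.

End Container.

(** * Simple hypergraphs *)

Section Online.
Variables (R : realType) (n r : nat) (G : hypergraph 'I_n r) (tau zeta : R).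
Hypotheses (tau_gt0 : 0 < tau) (GV : vset G = [set: 'I_n]) (G_simple : is_simple G).
Implicit Types (E A : {set {set 'I_n}}) (e sigma S : {set 'I_n}) (v u : 'I_n).
Implicit Types (F : nat -> {set 'I_n}) (s k : nat).

Local Notation level := (level G tau zeta).
Local Notation link := (link G tau zeta).
Local Notation hits := (hits G tau zeta).
Local Notation d v := ((degree G [set v])%:R : R).

Lemma simple_eq e e' sigma : e \in edges G -> e' \in edges G ->
  sigma \subset e -> sigma \subset e' -> (1 < #|sigma|)%N -> e = e'.
Proof.
move=> eG e'G sub sub' /card_gt1P[u [v [us vs neq_uv]]].
have := G_simple (_ : u \in vset G) (_ : v \in vset G) neq_uv.
rewrite GV !in_setT => /(_ isT isT); rewrite leqNgt; apply: contraNeq => neq_ee'.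
apply/card_gt1P; exists e, e'; split=> //; rewrite inE ?eG ?e'G /=;
  by rewrite subUset !sub1set !(subsetP sub, subsetP sub').
Qed.

(** A set of two or more vertices that blocks [e] also lies in an edge collected
earlier, which simplicity forbids. *)
Lemma blocked_simple s E A e v : (s < r)%N -> E \subset edges G -> A \subset E ->
  e \in E -> v \in lead s e ->
  (forall e', e' \in A -> exists2 v', v' \in lead s e' & (v' < v)%N) ->
  blocked G tau s E A e
    = [exists u in suf s e, tau ^+ (r - s) * d u <= (ldeg s A [set u])%:R].
Proof.
move=> lt_sr sEG sAE eE vl before_v.
apply/existsP/exists_inP => [[sigma /and3P[sub sigma0 le_cap]]|[u us le_u]]; last first.
  by exists [set u]; rewrite sub1set us -card_gt0 cards1 /= /cap cards1 eqxx.
have [le1|gt1] := leqP #|sigma| 1.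
  have /cards1P[u su] : #|sigma| == 1%N by rewrite eqn_leq le1 card_gt0.
  by exists u; move: sub le_cap; rewrite su ?sub1set // /cap cards1 eqxx.
have E_gt0 : (0 < ldeg s.+1 E sigma)%N.
  by apply/card_gt0P; exists e; rewrite inE eE (subset_trans sub (sufS _ _)).
have : (0 < ldeg s A sigma)%N.
  rewrite -(ltr0n R); apply: lt_le_trans le_cap; rewrite /cap gtn_eqF //.
  by rewrite !mulr_gt0 ?exprn_gt0 ?ltr0n.
case/card_gt0P=> e'; rewrite inE => /andP[e'A sub'].
have ee' : e = e'.
  apply: (@simple_eq _ _ sigma) => //; first exact: (subsetP sEG).
  - exact: subsetP (subset_trans sAE sEG) _ e'A.
  - exact: subset_trans sub (suf_sub _ _).
  - exact: subset_trans sub' (suf_sub _ _).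
have [v' v'l lt_v'v] := before_v e' e'A.
have /card1P[w lw] : #|lead s e| == 1%N.
  by rewrite card_lead // (card_edge (subsetP sEG _ eE)).
by move: vl v'l lt_v'v; rewrite -ee' !lw !inE => /eqP-> /eqP->; rewrite ltnn.
Qed.

Lemma fresh_simple s E E' A v : (s < r)%N -> E \subset edges G -> E' \subset edges G ->
  A \subset E -> A \subset E' ->
  (forall e', e' \in A -> exists2 v', v' \in lead s e' & (v' < v)%N) ->
  (forall e, v \in suf s.+1 e -> (e \in E) = (e \in E')) ->
  fresh G tau s E A v = fresh G tau s E' A v.
Proof.
move=> lt_sr sEG sE'G sAE sAE' before_v eqE; apply/setP => e.
rewrite inE [in RHS]inE; case: (boolP (v \in lead s e)) => [vl|]; last by rewrite !andbF.
have vs : v \in suf s.+1 e by move: vl; rewrite inE => /andP[].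
rewrite -(eqE e vs); case: (boolP (e \in E)) => //= eE.
by rewrite !(@blocked_simple s _ A e v) // -?(eqE e vs).
Qed.

Lemma link_lead s E S k e : e \in link s E S k ->
  exists2 v, v \in lead s e & (v < k)%N.
Proof. by case/mem_link => v [lt_vk _ _]; rewrite inE => /and3P[_ vl _]; exists v. Qed.

Lemma link_simple s E E' S S' w : (s < r)%N -> E \subset edges G -> E' \subset edges G ->
  (forall v, (v < w)%N -> (v \in S) = (v \in S')) ->
  (forall e v, v \in suf s.+1 e -> (v < w)%N -> (e \in E) = (e \in E')) ->
  forall k, (k <= w)%N -> link s E S k = link s E' S' k.
Proof.
move=> lt_sr sEG sE'G eqS eqE; elim=> [//|k IH] lt_kw /=.
have Ik := IH (ltnW lt_kw).
have eqF v : val v = k ->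
    fresh G tau s E (link s E S k) v = fresh G tau s E' (link s E' S' k) v.
  move=> vk; rewrite -Ik; apply: fresh_simple => //.
  - exact: link_sub.
  - by rewrite Ik link_sub.
  - by move=> e' /link_lead[v' v'l lt_v'k]; exists v' => //; rewrite vk.
  - by move=> e vs; apply: (eqE e v) => //; rewrite vk.
rewrite -Ik; congr (_ :|: _); apply: eq_big => [v|v /and3P[_ /eqP vk _]].
  case: (eqVneq (val v) k) => [vk|]; last by rewrite !andbF.
  by rewrite eqS ?vk // /hit eqF // -Ik.
by rewrite eqF // -Ik.
Qed.

(** Whether [e] reaches level [s] is decided when its lead vertex is examined, before any
vertex of [suf s e]. *)
Lemma level_simple F F' w : (w <= n)%N ->
  (forall s v, (s < r)%N -> (v < w)%N -> (v \in F s) = (v \in F' s)) ->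
  forall s, (s <= r)%N -> forall e v, v \in suf s e -> (v < w)%N ->
    (e \in level F s) = (e \in level F' s).
Proof.
move=> le_wn eqF; apply: level_ind => [|s lt_sr IH] e v vs lt_vw; first by rewrite !level_top.
have eqL : link s (level F s.+1) (F s) w = link s (level F' s.+1) (F' s) w.
  apply: (@link_simple _ _ _ _ _ w) => //; rewrite ?level_edges //.
  by move=> u; apply: eqF.
have bound E S : (e \in link s E S n) = (e \in link s E S w).
  apply/idP/idP; last exact/subsetP/link_mono.
  case/mem_link=> u [_ uS uhit uF]; apply/mem_link; exists u; split=> //.
  apply: ltn_trans lt_vw; apply: lead_lt vs.
  by move: uF; rewrite inE => /and3P[].
by rewrite (levelE _ _ _ F) // (levelE _ _ _ F') // !bound eqL.
Qed.

Lemma hits_simple F F' w : (w <= n)%N ->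
  (forall s v, (s < r)%N -> (v < w)%N -> (v \in F s) = (v \in F' s)) ->
  forall s v, (s < r)%N -> (v < w)%N -> (v \in hits F s) = (v \in hits F' s).
Proof.
move=> le_wn eqF s v lt_sr lt_vw.
have eqE e u : u \in suf s.+1 e -> (u < w)%N ->
    (e \in level F s.+1) = (e \in level F' s.+1).
  exact: (level_simple le_wn eqF lt_sr).
have eqL : before G tau zeta F s v = before G tau zeta F' s v.
  apply: (@link_simple _ _ _ _ _ w) => //; rewrite ?level_edges //; last exact: ltnW.
  by move=> u; apply: eqF.
rewrite inE [in RHS]inE /hit -eqL (@fresh_simple _ _ (level F' s.+1)) ?level_edges //.
- exact: link_sub.
- by rewrite eqL link_sub.
- by move=> e' /link_lead.
- by move=> e vs; apply: eqE vs lt_vw.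
Qed.

Lemma container_simple F F' w : (w <= n)%N ->
  (forall s v, (s < r)%N -> (v < w)%N -> (v \in F s) = (v \in F' s)) ->
  forall v, (v < w)%N ->
    (v \in container G tau zeta F) = (v \in container G tau zeta F').
Proof.
move=> le_wn eqF v lt_vw; rewrite inE [in RHS]inE; apply: eq_forallb => s.
by rewrite (hits_simple le_wn eqF) // eqF.
Qed.

End Online.

(** * Fingerprints as tuples, and the theorem *)

Section Tuples.
Variables (n r : nat).
Implicit Types (F : nat -> {set 'I_n}) (T : set_tuple n r).

Definition tuple_fun T : nat -> {set 'I_n} :=
  fun s => if insub s is Some i then T i else set0.

Lemma tuple_fun_ord T (i : 'I_r) : tuple_fun T i = T i.
Proof. by rewrite /tuple_fun valK. Qed.

Lemma tuple_fun_ffun F s : (s < r)%N -> tuple_fun [ffun i : 'I_r => F i] s = F s.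
Proof. by move=> lt_sr; rewrite -[s]/(val (Ordinal lt_sr)) tuple_fun_ord ffunE. Qed.

Lemma tuple_fun_cap T w s (v : 'I_n) : (s < r)%N -> (v < w)%N ->
  (v \in tuple_fun T s) = (v \in tuple_fun (tuple_cap T w) s).
Proof.
move=> lt_sr lt_vw; rewrite -[s]/(val (Ordinal lt_sr)) !tuple_fun_ord ffunE.
by rewrite !inE lt_vw andbT.
Qed.

End Tuples.

(** In these cases the bound on the container allows for the whole vertex set. *)
Lemma measure_setT_le (R : realType) (n r : nat) (G : hypergraph 'I_n r)
    (GV : vset G = [set: 'I_n]) (G_edge : (0 < nedges G)%N)
    (tau zeta : R) (tau_gt0 : 0 < tau) (zeta_gt0 : 0 < zeta) :
  (r == 0)%N || (1 <= 4 * zeta) ->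
  degree_measure R G [set: 'I_n] <= 1 - r`!%:R^-1 + 4 * zeta + 2 * r%:R * tau / zeta.
Proof.
have z4 : 0 < 4 * zeta by rewrite mulr_gt0.
case: (posnP r) => [r0 _|r_gt0 /= le1].
  rewrite /degree_measure big1 => [|u _]; last first.
    rewrite /degree (_ : [set _ in _ | _] = set0) ?cards0 //.
    apply/setP => e; rewrite !inE; apply/negP => /andP[eG].
    by move/subset_leq_card; rewrite cards1 (card_edge eG) r0.
  by rewrite mul0r r0 invr1 subrr add0r mulr0 !mul0r addr0 ltW.
rewrite measure_setT //; have : 0 <= 2 * r%:R * tau / zeta.
  by rewrite divr_ge0 ?mulr_ge0 ?(ltW tau_gt0) ?(ltW zeta_gt0).
have : r`!%:R^-1 <= 1 :> R by rewrite invf_le1 ?ler1n ?ltr0n ?fact_gt0.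
lra.
Qed.

Lemma sparse_fingerprint (R : realType) (n r : nat) (G : hypergraph 'I_n r)
    (GV : vset G = [set: 'I_n]) (G_edge : (0 < nedges G)%N) (r_gt0 : (0 < r)%N)
    (tau zeta : R) (tau_gt0 : 0 < tau) (zeta_gt0 : 0 < zeta)
    (G_delta : codegree_fun G tau <= zeta) (zeta_le1 : zeta <= 1) (I : {set 'I_n}) :
  is_degenerate (Num.floor (tau ^+ r.-1 * zeta * (nedges G)%:R / n%:R)) (induced G I) \/
  (nedges (induced G I))%:R <= 2 * r%:R * tau ^+ r * (nedges G)%:R / zeta ->
  exists T : set_tuple n r,
    [/\ forall i, T i \subset I,
        I \subset container G tau zeta (tuple_fun T),
        forall i, degree_measure R G (T i) <= 2 * tau / zeta,
        forall i, #|T i|%:R <= 2 * tau * n%:R / zeta ^+ 2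
      & degree_measure R G (container G tau zeta (tuple_fun T))
          <= 1 - r`!%:R^-1 + 4 * zeta + 2 * r%:R * tau / zeta].
Proof.
move=> sparse; pose F (s : nat) := I; pose P := picked G tau zeta F.
pose T : set_tuple n r := [ffun i : 'I_r => P i].
have TP s : (s < r)%N -> tuple_fun T s = P s by exact: tuple_fun_ffun.
have PI s : P s \subset I := subsetIl _ _.
have muP s : (0 < s < r)%N -> degree_measure R G (P s) <= 2 * tau / zeta.
  exact: measure_picked.
have cardP s : degree_measure R G (P s) <= 2 * tau / zeta ->
    #|P s|%:R <= 2 * tau * n%:R / zeta ^+ 2.
  have -> : 2 * tau * n%:R / zeta ^+ 2 = 2 * tau / zeta * n%:R / zeta.
    by field; rewrite gt_eqF.
  by apply: card_heavy => //; exact: picked_heavy.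
have mu0 : degree_measure R G (P 0) <= 2 * tau / zeta.
  by apply: (@measure_picked0 _ _ _ G tau zeta _ _ _ _ _ F I) => // s /muP/cardP.
have mu_all s : (s < r)%N -> degree_measure R G (P s) <= 2 * tau / zeta.
  by case: s => [//|s] lt_sr; apply: muP.
exists T; split=> [i||i|i|].
- by rewrite ffunE.
- apply/subsetP => v vI; rewrite inE; apply/forallP => s; apply/implyP.
  rewrite (hits_picked TP) // TP // => vh.
  by rewrite inE vI.
- by rewrite ffunE mu_all.
- by rewrite ffunE cardP ?mu_all.
apply: measure_container => //; rewrite /picked (hits_picked TP) // TP //.
by rewrite /P /picked -setIA setIid.
Qed.

Theorem theorem3p4 (R : realType) (n r : nat) (G : hypergraph 'I_n r)
    (GV : vset G = [set: 'I_n]) (G_edge : (0 < nedges G)%N)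
    (tau zeta : R) (tau_gt0 : 0 < tau) (zeta_gt0 : 0 < zeta)
    (G_delta : codegree_fun G tau <= zeta) :
  exists C : set_tuple n r -> {set 'I_n},
    [/\ forall I : {set 'I_n}, is_independent G I ->
          exists T : set_tuple n r,
            [/\ forall i, T i \subset I,
                I \subset C T,
                forall i, degree_measure R G (T i) <= 2 * tau / zeta,
                forall i, #|T i|%:R <= 2 * tau * n%:R / zeta ^+ 2
              & degree_measure R G (C T)
                  <= 1 - r`!%:R^-1 + 4 * zeta + 2 * r%:R * tau / zeta],
        is_simple G ->
          forall (T : set_tuple n r) (w : nat), (0 < w <= n)%N ->
            C T :&: initseg n w = C (tuple_cap T w) :&: initseg n w
      & forall I : {set 'I_n},
          is_degenerate
            (Num.floor (tau ^+ r.-1 * zeta * (nedges G)%:R / n%:R))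
            (induced G I) \/
          (nedges (induced G I))%:R
            <= 2 * r%:R * tau ^+ r * (nedges G)%:R / zeta ->
          exists T : set_tuple n r,
            [/\ forall i, T i \subset I,
                I \subset C T,
                forall i, degree_measure R G (T i) <= 2 * tau / zeta,
                forall i, #|T i|%:R <= 2 * tau * n%:R / zeta ^+ 2
              & degree_measure R G (C T)
                  <= 1 - r`!%:R^-1 + 4 * zeta + 2 * r%:R * tau / zeta]].
Proof.
have [triv|] := boolP ((r == 0)%N || (1 <= 4 * zeta)).
  have all_sets (I : {set 'I_n}) : exists T : set_tuple n r,
      [/\ forall i, T i \subset I, I \subset [set: 'I_n],
          forall i, degree_measure R G (T i) <= 2 * tau / zeta,
          forall i, #|T i|%:R <= 2 * tau * n%:R / zeta ^+ 2
        & degree_measure R G [set: 'I_n]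
            <= 1 - r`!%:R^-1 + 4 * zeta + 2 * r%:R * tau / zeta].
    exists [ffun=> set0]; split=> [i||i|i|]; rewrite ?ffunE ?sub0set ?subsetT //.
    - rewrite /degree_measure big_set0 mul0r.
      by rewrite divr_ge0 ?mulr_ge0 ?(ltW tau_gt0) ?(ltW zeta_gt0).
    - by rewrite cards0 divr_ge0 ?mulr_ge0 ?exprn_ge0 ?(ltW tau_gt0) ?(ltW zeta_gt0).
    - exact: measure_setT_le.
  by exists (fun=> [set: 'I_n]); split=> // I _; exact: all_sets.
rewrite negb_or -lt0n -ltNge => /andP[r_gt0 lt4].
have zeta_le1 : zeta <= 1 by move: zeta_gt0; lra.
have main := sparse_fingerprint GV G_edge r_gt0 tau_gt0 zeta_gt0 G_delta zeta_le1.
exists (fun T => container G tau zeta (tuple_fun T)); split=> [I [_ indep]||]; last exact: main.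
  apply: main; right; rewrite (_ : nedges (induced G I) = 0%N).
    by rewrite divr_ge0 ?mulr_ge0 ?exprn_ge0 ?(ltW tau_gt0) ?(ltW zeta_gt0).
  apply: eq_card0 => e; rewrite inE /=; apply/negP => /andP[eG].
  exact/negP/indep.
move=> G_simple T w /andP[_ le_wn]; apply/setP => v; rewrite !in_setI [v \in initseg n w]inE.
case: (ltnP v w) => [lt_vw|]; rewrite ?andbF ?andbT //.
apply: (container_simple zeta tau_gt0 GV G_simple le_wn _ lt_vw) => s u.
exact: tuple_fun_cap.
Qed.
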